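(* Let $1\le p\le\infty$ and $0<q\le\infty$. Let $U$ be a regular kernel on $\mathbb Z\times\mathbb Z$ and let $\{v_n\}_{n\in\mathbb Z},\{w_n\}_{n\in\mathbb Z}$ be sequences of nonnegative real numbers. Extend $U$ to $\mathbb R^2$ by $$U(s,t)=\sum_{(i,n)\in\mathbb Z^2}U(i,n)\chi_{(i-1,i]\times(n-1,n]}(s,t),\quad s,t\in\mathbb R,$$ and define $v(t)=\sum_{n\in\mathbb Z}v_n\chi_{(n-1,n]}(t)$, $w(t)=\sum_{n\in\mathbb Z}w_n\chi_{(n-1,n]}(t)$ for $t\in\mathbb R$. Then there is a constant $C$ such that $$\Big(\sum_{n\in\mathbb Z}\Big(\sum_{i=-\infty}^nU(i,n)a_i\Big)^qw_n\Big)^{1/q}\le C\Big(\sum_{n\in\mathbb Z}a_n^pv_n\Big)^{1/p}$$ for every sequence $\{a_n\}_{n\in\mathbb Z}$ of nonnegative real numbers if and only if there is a constant $C'$ such that $$\Big(\int_{-\infty}^\infty\Big(\int_{-\infty}^tU(s,t)f(s)\,ds\Big)^qw(t)\,dt\Big)^{1/q}\le C'\Big(\int_{-\infty}^\infty f(t)^pv(t)\,dt\Big)^{1/p}$$ for every nonnegative measurable function $f$ on $\mathbb R$. Moreover, if $C,C'$ are the optimal constants, then $C'\le C\le 2^{1+\frac1q}C'$.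
   Context: A function $U\colon\mathbb Z\times\mathbb Z\to[0,\infty)$ is a regular kernel if it is nonincreasing in the first variable, nondecreasing in the second variable, and there is a positive constant $c$ (the constant of regularity) with $U(i,n)\le c(U(i,j)+U(j,n))$ for all integers $i\le j\le n$. Sums and integrals take values in $[0,\infty]$, with $0\cdot\infty=0$. When $q=\infty$, the left-hand sides are replaced by $\sup_{n}w_n\sum_{i\le n}U(i,n)a_i$ and $\operatorname{ess\,sup}_tw(t)\int_{-\infty}^tU(s,t)f(s)\,ds$, and $\frac1q=0$. When $p=\infty$, the right-hand sides are replaced by $C\sup_na_nv_n$ and $C'\operatorname{ess\,sup}_tf(t)v(t)$. *)

(* Defs.v *)
From HB Require Import structures.
From mathcomp Require Import all_boot all_order all_algebra.
From mathcomp Require Import all_classical all_reals all_analysis.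
From mathcomp Require Import ess_sup_inf.

Set Implicit Arguments.
Unset Strict Implicit.
Unset Printing Implicit Defensive.

Import Order.TTheory GRing.Theory Num.Theory.
Import numFieldNormedType.Exports.

Local Open Scope classical_set_scope.
Local Open Scope ring_scope.

(* [lebesgueR R] is the real line with its Lebesgue sigma-algebra (the
   Caratheodory one), i.e. the domain of [completed_lebesgue_measure]; the
   default sigma-algebra on [R] in MathComp-Analysis is the smaller Borel one. *)
Definition lebesgueR (R : realType) : measurableType _ :=
  caratheodory_type (@wlength R idfun)^*%mu.

Notation leb R := (@completed_lebesgue_measure R).

Section Definitions.
Context {R : realType}.
Implicit Types (U : int -> int -> R) (a v w : int -> R).

Definition regular_kernel U : Prop :=
  [/\ forall i n, 0 <= U i n,
      forall i j n, i <= j -> U j n <= U i n,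
      forall i m n, m <= n -> U i m <= U i n
    & exists2 c : R, 0 < c &
        forall i j n, i <= j -> j <= n -> U i n <= c * (U i j + U j n)].

Definition cell (n : int) : set R := `]n%:~R - 1, n%:~R].

Local Open Scope ereal_scope.

Definition step_kernel U (s t : R) : \bar R :=
  \esum_(k in [set: int * int])
    (U k.1 k.2 * \1_(cell k.1 `*` cell k.2) (s, t))%:E.

Definition step_weight v (t : R) : \bar R :=
  \esum_(n in [set: int]) (v n * \1_(cell n) t)%:E.

(* In the four definitions below the exponent is meant to lie in ]0, +oo]; the
   value at -oo is irrelevant.  In [\bar R] one has 0 * +oo = 0. *)
Definition discrete_lhs (q : \bar R) U w a : \bar R :=
  let T (n : int) := \esum_(i in [set i : int | (i <= n)%R]) (U i n * a i)%:E in
  match q with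
  | r%:E => (\esum_(n in [set: int]) (T n `^ r * (w n)%:E)) `^ r^-1
  | _ => ereal_sup (range (fun n : int => (w n)%:E * T n))
  end.

Definition discrete_rhs (p : \bar R) v a : \bar R :=
  match p with
  | r%:E => (\esum_(n in [set: int]) ((a n)%:E `^ r * (v n)%:E)) `^ r^-1
  | _ => ereal_sup (range (fun n : int => (a n)%:E * (v n)%:E))
  end.

Definition continuous_lhs (q : \bar R) (U : R -> R -> \bar R) (w : R -> \bar R)
    (f : R -> R) : \bar R :=
  let T t := \int[leb R]_(s in `]-oo, t]) (U s t * (f s)%:E) in
  match q with
  | r%:E => (\int[leb R]_t (T t `^ r * w t)) `^ r^-1
  | _ => ess_sup (leb R) (fun t => w t * T t)
  end.

Definition continuous_rhs (p : \bar R) (v : R -> \bar R) (f : R -> R) : \bar R :=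
  match p with
  | r%:E => (\int[leb R]_t ((f t)%:E `^ r * v t)) `^ r^-1
  | _ => ess_sup (leb R) (fun t => (f t)%:E * v t)
  end.

Definition discrete_constants (p q : \bar R) U v w : set R :=
  [set C : R | (0 <= C)%R /\
    forall a, (forall n, 0 <= a n)%R ->
      discrete_lhs q U w a <= C%:E * discrete_rhs p v a].

Definition continuous_constants (p q : \bar R) (U : R -> R -> \bar R)
    (v w : R -> \bar R) : set R :=
  [set C : R | (0 <= C)%R /\
    forall f : R -> R, (forall t, 0 <= f t)%R ->
      measurable_fun [set: lebesgueR R] (f : lebesgueR R -> R) ->
      continuous_lhs q U w f <= C%:E * continuous_rhs p v f].

(* +oo when no constant is admissible *)
Definition optimal_constant (S : set R) : \bar R :=
  ereal_inf [set C%:E | C in S].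

End Definitions.

(* Main.v *)
Require Import Defs.
From HB Require Import structures.
From mathcomp Require Import all_boot all_order all_algebra.
From mathcomp Require Import all_classical all_reals all_analysis.
From mathcomp Require Import ring.
From mathcomp Require Import measurable_realfun ess_sup_inf.

Set Implicit Arguments.
Unset Strict Implicit.
Unset Printing Implicit Defensive.

Import Order.TTheory GRing.Theory Num.Theory.
Import numFieldNormedType.Exports.

Local Open Scope classical_set_scope.
Local Open Scope ring_scope.

(** Because the kernel and the weights are constant on the cells ]n - 1, n],
    both inequalities compare the same sums, and the two directions are two ways
    of passing between functions and sequences.

    From sequences to functions ([sub_discrete_continuous_constants]): replace f
    by its cell averages A n, the integral of f over the n-th cell, which has
    length 1. For t in the n-th cell the operator applied to f is at most the
    sum of U(i, n) A i over i <= n ([step_hardy_le]), so the left-hand side can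
    only grow, while Hoelder's inequality on each cell (or averages lying below
    the essential supremum) shows that the right-hand side can only decrease
    ([discrete_rhs_average_le]). Hence every discrete constant is a continuous
    constant. The averages may be infinite, whereas the discrete inequality is
    about real sequences, so the test sequence is [fine (A n)], which has 0
    where A n is infinite. This loses nothing: if the right-hand side C * ||f||
    is finite and A i is infinite, then C * v i = 0 ([continuous_rhs_pinfty]), and
    the discrete inequality tested on the unit sequence at i forces U(i, n) to
    vanish for all n >= i with w n <> 0 ([discrete_constants_vanish]).

    From functions to sequences ([discrete_constants_scale]): given a, test on
    the function equal to a n on the n-th cell. Its right-hand side is exactly
    the discrete one. When t lies in the right half of the n-th cell, the
    integral up to t already covers every earlier cell and half of the n-th, so
    it is at least half of the discrete sum ([step_hardy_ge]). Right halves
    having measure 1/2, the left-hand side loses a factor 1/2 from the inner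
    integral and 2^(-1/q) from the outer one ([discrete_lhs_le_ceil]); for
    q = oo only the first factor appears, since a set of
    measure 1/2 is enough to bound an essential supremum from below. *)

(** * Sums over countable sets and integrals over countable partitions *)

Section countable_sums.
Context {R : realType}.
Local Open Scope ereal_scope.

Lemma ge0_esumZl (T : choiceType) (I : set T) (k : R) (a : T -> \bar R) :
  (0 <= k)%R -> (forall i, 0 <= a i) ->
  \esum_(i in I) (k%:E * a i) = k%:E * \esum_(i in I) a i.
Proof.
move=> k0 a0; have [->|kN0] := eqVneq k 0%R.
  by rewrite mul0e esum1// => i _; rewrite mul0e.
rewrite /esum -ereal_sup_pZl ?lt_neqAle 1?eq_sym ?kN0// image_comp.
congr (ereal_sup _); apply: eq_imagel => F _ /=.
by rewrite ge0_mule_fsumr.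
Qed.

Lemma esum_single (T : choiceType) (I : set T) (i : T) (a : T -> \bar R) :
  I i -> (forall j, 0 <= a j) -> (forall j, I j -> j <> i -> a j = 0) ->
  \esum_(j in I) a j = a i.
Proof.
move=> Ii a0 ai; rewrite (esumID [set i])//.
rewrite (_ : I `&` [set i] = [set i]); last first.
  by apply/seteqP; split => [j [_]//|j /= ->].
by rewrite esum_set1// [X in _ + X]esum1 ?adde0// => j [/= Ij ij]; exact: ai.
Qed.

(** Bridge from sums over a countable type to series over [nat], the form in
    which countable additivity of the integral is available: [pickle] embeds [I]
    into [nat], and indices outside its range contribute 0. *)
Lemma nneseries_pickle (I : countType) (a : I -> \bar R) :
  (forall i, 0 <= a i) ->
  \sum_(0 <= k <oo) oapp a 0 (pickle_inv k) = \esum_(i in [set: I]) a i.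
Proof.
move=> a0; rewrite nneseries_esumT; last by move=> k; case: pickle_inv => /=.
rewrite (esumID [set pickle i | i in [set: I]]) ?setTI; last first.
  by move=> k _; case: pickle_inv => /=.
rewrite [X in _ + X]esum1 ?adde0; last first.
  move=> k /= kI; case: (pickle_inv k) (@pickle_invK I k) => [i /= ik|//].
  by case: kI; exists i => //; rewrite ik.
rewrite (@reindex_esum _ I _ setT _ pickle); last first.
  by apply: inj_bij => i j _ _; exact: (pcan_inj pickleK_inv).
by apply: eq_esum => i _; rewrite pickleK_inv.
Qed.

End countable_sums.

Section integrals.
Context d (T : measurableType d) (R : realType) (mu : {measure set T -> \bar R}).
Local Open Scope ereal_scope.

(** The integral of a nonnegative function is the supremum of the integrals of
    the simple functions below it, hence monotone even among nonmeasurable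
    functions. The integrands to be compared are weighted powers of
    t |-> \int_(s <= t) U(s, t) f(s). *)
Lemma le_integralT (f g : T -> \bar R) :
  (forall x, 0 <= f x) -> (forall x, f x <= g x) ->
  \int[mu]_x f x <= \int[mu]_x g x.
Proof.
move=> f0 fg; have g0 x : 0 <= g x by exact: le_trans (fg x).
rewrite !ge0_integralTE//; apply: ereal_sup_le => _ [h /= hf <-].
exists h => //= x; exact: le_trans (fg x).
Qed.

Lemma integral_partition (I : countType) (F : I -> set T) (f : T -> \bar R) :
  (forall i, measurable (F i)) -> trivIset setT F -> \bigcup_i F i = setT ->
  (forall x, 0 <= f x) -> measurable_fun setT f ->
  \int[mu]_x f x = \esum_(i in [set: I]) \int[mu]_(x in F i) f x.
Proof.
move=> mF tF FT f0 mf.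
pose G k := oapp F set0 (pickle_inv k : option I).
have GT : \bigcup_k G k = setT.
  rewrite -subTset -FT => x [i _ Fix]; exists (pickle i) => //.
  by rewrite /G pickleK_inv.
rewrite -GT ge0_integral_bigcup ?GT//.
- rewrite -nneseries_pickle; last by move=> i; exact: integral_ge0.
  apply: eq_eseriesr => k _; rewrite /G; case: pickle_inv => //=.
  by rewrite integral_set0.
- by move=> k; rewrite /G; case: pickle_inv => //=.
- move=> j k _ _; rewrite /G.
  case: (pickle_inv j) (@pickle_invK I j) => [i /= <-|_ [x []]//].
  case: (pickle_inv k) (@pickle_invK I k) => [i' /= <-|_ [x []]//].
  by move=> /tF ->.
Qed.

(** Jensen's inequality for a power on a set of measure 1, obtained from
    Hoelder's inequality against the indicator function of [D]; the left-hand
    integral may be infinite. *)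
Lemma poweR_le_integral_poweR (D : set T) (f : T -> R) (r : R) :
  measurable D -> mu D = 1 -> measurable_fun setT f ->
  (forall x, 0 <= f x)%R -> (1 <= r)%R ->
  (\int[mu]_(x in D) (f x)%:E) `^ r <= \int[mu]_(x in D) ((f x)%:E `^ r).
Proof.
move=> mD D1 mf f0 r1.
have r0 : (0 < r)%R by exact: lt_le_trans r1.
have I0 : 0 <= \int[mu]_(x in D) (f x)%:E.
  by apply: integral_ge0 => x _; rewrite lee_fin.
have [->|rN1] := eqVneq r 1%R.
  by rewrite poweRe1//; under [leRHS]eq_integral do rewrite poweRe1 ?lee_fin//.
(* the exponent conjugate to [r] *)
pose s := (r / (r - 1))%R.
have r10 : (0 < r - 1)%R by rewrite subr_gt0 lt_neqAle eq_sym rN1.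
have s0 : (0 < s)%R by rewrite divr_gt0.
have rs : (r^-1 + s^-1 = 1)%R.
  by rewrite /s invf_div mulrBl divff ?gt_eqF// mul1r addrC subrK.
have mfD : measurable_fun setT (f \* \1_D)%R.
  by apply: measurable_funM => //; exact: measurable_indic.
have := hoelder mu mfD (measurable_indic mD) r0 s0 rs.
have E1 : 'N[mu]_1[EFin \o ((f \* \1_D) \* \1_D)%R] =
    \int[mu]_(x in D) (f x)%:E.
  rewrite Lnorm1 [RHS]integral_mkcond; apply: eq_integral => x _ /=.
  rewrite patchE indicE; case: (x \in D); last by rewrite !mulr0 normr0.
  by rewrite !mulr1 ger0_norm.
have E2 : 'N[mu]_r%:E[EFin \o (f \* \1_D)%R] =
    (\int[mu]_(x in D) ((f x)%:E `^ r)) `^ r^-1.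
  rewrite unlock [in RHS]integral_mkcond; congr (_ `^ _).
  apply: eq_integral => x _ /=.
  rewrite patchE indicE; case: (x \in D).
    by rewrite !mulr1 ger0_norm.
  by rewrite !mulr0 normr0 powR0 ?gt_eqF.
have E3 : 'N[mu]_s%:E[EFin \o (\1_D : T -> R)] = 1.
  have -> : 'N[mu]_s%:E[EFin \o (\1_D : T -> R)] = mu D `^ s^-1.
    rewrite unlock -[in RHS](setIT D) -integral_indic//; congr (_ `^ _).
    apply: eq_integral => x _ /=; rewrite indicE.
    by case: (x \in D); rewrite ?normr1 ?normr0 ?powR1// powR0 ?gt_eqF.
  by rewrite D1 poweR1r.
rewrite E1 E2 E3 mule1 => H.
have P0 : 0 <= \int[mu]_(x in D) ((f x)%:E `^ r).
  by apply: integral_ge0 => x _; exact: poweR_ge0.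
have := @gt0_ler_poweR R r (ltW r0) _ _ _ _ H.
rewrite -poweRrM mulVf ?gt_eqF// poweRe1//; apply.
  by rewrite in_itv/= I0 leey.
by rewrite in_itv/= poweR_ge0 leey.
Qed.

End integrals.

(** * The unit cells *)

Section cells.
Context {R : realType}.
Implicit Types (n : int) (t : R).

Lemma cellP n t : cell n t <-> Num.ceil t = n.
Proof.
rewrite /cell /= in_itv /= -[(n%:~R - 1)%R](intrB _ n 1).
by split => [/ceil_def//|<-]; exact: ceil_itv.
Qed.

Lemma indic_cell n t : \1_(cell n) t = (Num.ceil t == n)%:R :> R.
Proof.
rewrite indicE; congr (_ %:R); congr nat_of_bool.
by apply/idP/eqP => [/set_mem/cellP//|/cellP/mem_set].
Qed.

Local Open Scope ereal_scope.

Lemma step_weightE (v : int -> R) t : (forall n, 0 <= v n)%R ->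
  step_weight v t = (v (Num.ceil t))%:E.
Proof.
move=> v0; rewrite /step_weight (@esum_single _ _ _ (Num.ceil t))//.
- by rewrite indic_cell eqxx mulr1.
- by move=> n; rewrite lee_fin mulr_ge0// indic_cell ler0n.
- move=> n _ nt; rewrite indic_cell (_ : _ == _ = false) ?mulr0//.
  by apply/eqP => /esym.
Qed.

Lemma step_kernelE (U : int -> int -> R) s t : (forall i n, 0 <= U i n)%R ->
  step_kernel U s t = (U (Num.ceil s) (Num.ceil t))%:E.
Proof.
move=> U0; rewrite /step_kernel.
have cellX (k : int * int) :
    \1_(cell k.1 `*` cell k.2) (s, t) = ((Num.ceil s, Num.ceil t) == k)%:R :> R.
  rewrite indicE; congr (_ %:R); congr nat_of_bool; case: k => i n /=.
  apply/idP/eqP => [/set_mem[/= /cellP -> /cellP ->]//|[<- <-]].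
  by apply/mem_set; split; exact/cellP.
rewrite (@esum_single _ _ _ (Num.ceil s, Num.ceil t))//.
- by rewrite cellX eqxx mulr1.
- by move=> k; rewrite lee_fin mulr_ge0// cellX ler0n.
- move=> k _ kst; rewrite cellX (_ : _ == _ = false) ?mulr0//.
  by apply/eqP => /esym.
Qed.

Lemma measurable_itv_leb (i : interval R) :
  measurable ([set` i] : set (lebesgueR R)).
Proof.
by apply: sub_caratheodory; exact: measurable_itv.
Qed.

Lemma leb_itv_bndc (x y : R) : (x <= y)%R -> leb R `]x, y] = (y - x)%:E.
Proof.
move=> xy; transitivity (lebesgue_measure (`]x, y]%classic : set R)) => //.
rewrite lebesgue_measure_itv/= lte_fin lt_neqAle xy andbT -EFinB.
by case: eqVneq => [->|]//=; rewrite subrr.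
Qed.

Lemma leb_cell n : leb R (cell n) = 1.
Proof. by rewrite /cell leb_itv_bndc ?lerBlDr ?lerDl// opprB addrC subrK. Qed.

Lemma bigcup_cell : \bigcup_n cell n = [set: R].
Proof. by rewrite -subTset => t _; exists (Num.ceil t) => //; exact/cellP. Qed.

(** Preimages under [Num.ceil] are countable unions of cells. *)
Lemma measurable_fun_ceil d (Y : measurableType d) (g : int -> Y) :
  measurable_fun [set: lebesgueR R]
    (fun t : lebesgueR R => g (Num.ceil (t : R))).
Proof.
move=> _ B mB; rewrite setTI.
rewrite (_ : _ @^-1` B =
    \bigcup_(n in [set n | B (g n)]) (cell n : set (lebesgueR R))).
  rewrite bigcup_mkcond; apply: countable_bigcupT_measurable => [|n].
    exact: countableP.
  by case: ifP => _ ; [exact: measurable_itv_leb|exact: measurable0].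
apply/seteqP; split => [t Bt|t [n Bn /cellP tn]];
  last by rewrite /preimage /= tn.
by exists (Num.ceil (t : R)) => //; exact/cellP.
Qed.

Lemma integral_cells (f : lebesgueR R -> \bar R) :
  (forall t, 0 <= f t) -> measurable_fun [set: lebesgueR R] f ->
  \int[leb R]_t f t = \esum_(n in [set: int]) \int[leb R]_(t in cell n) f t.
Proof.
move=> f0 mf; apply: integral_partition => //.
- by move=> n; exact: measurable_itv_leb.
- by move=> i j _ _ [t [/cellP <- /cellP <-]].
- exact: bigcup_cell.
Qed.

Lemma integral_cell_cst n (c : \bar R) (f : lebesgueR R -> \bar R) :
  (forall t, cell n t -> f t = c) -> \int[leb R]_(t in cell n) f t = c.
Proof.
move=> fc; rewrite (eq_integral (cst c)) => [|t /set_mem/fc//].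
rewrite integral_cst; last exact: measurable_itv_leb.
by rewrite [X in _ * X]leb_cell mule1.
Qed.

Lemma integral_ceil (G : int -> \bar R) : (forall n, 0 <= G n) ->
  \int[leb R]_t G (Num.ceil (t : R)) = \esum_(n in [set: int]) G n.
Proof.
move=> G0; rewrite (@integral_cells (fun t => G (Num.ceil (t : R))))//; last first.
  exact: measurable_fun_ceil.
by apply: eq_esum => n _; apply: integral_cell_cst => t /cellP ->.
Qed.

End cells.

(** * The integral operator of a step kernel *)

Lemma mem_set_lez (i n : int) : (i \in [set j : int | j <= n]) = (i <= n).
Proof. by apply/idP/idP => [/set_mem|/mem_set]. Qed.

Section hardy_operators.
Context {R : realType}.
Variable U : int -> int -> R.
Hypothesis U0 : forall i n, 0 <= U i n.
Local Open Scope ereal_scope.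

(** Enlarging the domain from ]-oo, t] to the whole of the cell of [t] turns the
    integral into a sum over full cells, on each of which the kernel is
    constant. *)
Lemma step_hardy_le (f : R -> R) (t : R) : (forall s, 0 <= f s)%R ->
  measurable_fun [set: lebesgueR R] (f : lebesgueR R -> R) ->
  \int[leb R]_(s in `]-oo, t]) (step_kernel U s t * (f s)%:E) <=
  \esum_(i in [set i : int | (i <= Num.ceil t)%R])
    (U i (Num.ceil t))%:E * \int[leb R]_(s in cell i) (f s)%:E.
Proof.
move=> f0 mf; set n := Num.ceil t.
(* the value of U(., t) on the i-th cell, replaced by 0 after the n-th cell *)
pose c (i : int) : \bar R := if (i <= n)%R then (U i n)%:E else 0.
have c0 i : 0 <= c i by rewrite /c; case: ifP; rewrite ?lee_fin.
have mc := @measurable_fun_ceil R _ _ c.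
have mEf : measurable_fun [set: lebesgueR R] (fun s : lebesgueR R => (f s)%:E).
  exact/measurable_EFinP.
rewrite integral_mkcond.
apply: (@le_trans _ _ (\int[leb R]_s (c (Num.ceil (s : R)) * (f s)%:E))).
  apply: le_integralT => s.
    rewrite patchE; case: ifP => // _.
    by rewrite step_kernelE// mule_ge0 ?lee_fin.
  rewrite patchE; case: ifPn => [/set_mem/=|_]; last by rewrite mule_ge0 ?lee_fin.
  rewrite in_itv /= => st; rewrite step_kernelE// -/n /c.
  by rewrite ifT//; exact: le_ceil.
pose h (s : lebesgueR R) := c (Num.ceil (s : R)) * (f s)%:E.
have h0 s : 0 <= h s by rewrite mule_ge0 ?lee_fin.
have mh : measurable_fun [set: lebesgueR R] h by exact: emeasurable_funM.
rewrite (integral_cells h0 mh).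
rewrite [leRHS]esum_mkcond; apply: le_esum => i _.
rewrite (eq_integral (fun s : lebesgueR R => c i * (f s)%:E)); last first.
  by move=> s /set_mem/cellP si; rewrite /h si.
rewrite ge0_integralZl//.
- by rewrite /c mem_set_lez; case: ifP; rewrite ?mul0e.
- exact: measurable_itv_leb.
- exact: measurable_funTS.
- by move=> s _; rewrite lee_fin.
Qed.

(** When [t] lies in the right half of the n-th cell, every cell up to the n-th
    has at least its left half inside ]-oo, t]. *)
Lemma step_hardy_ge (a : int -> R) (n : int) (t : R) : (forall i, 0 <= a i)%R ->
  (n%:~R - 2^-1 < t <= n%:~R)%R ->
  (2^-1)%:E * (\esum_(i in [set i : int | (i <= n)%R]) (U i n * a i)%:E) <=
  \int[leb R]_(s in `]-oo, t]) (step_kernel U s t * (a (Num.ceil s))%:E).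
Proof.
move=> a0 /andP[nt tn].
have /cellP ctn : cell n t.
  rewrite /cell /= in_itv /= tn andbT (le_lt_trans _ nt)// lerD2l lerN2.
  by rewrite invf_le1// ler1n.
pose c (i : int) : \bar R := (U i n * a i)%:E.
have c0 i : 0 <= c i by rewrite lee_fin mulr_ge0.
pose g (s : lebesgueR R) := c (Num.ceil (s : R)).
have mg : measurable_fun [set: lebesgueR R] g by exact: measurable_fun_ceil.
have mD : measurable (`]-oo, t]%classic : set (lebesgueR R)).
  exact: measurable_itv_leb.
have mgD : measurable_fun [set: lebesgueR R] (g \_ `]-oo, t]).
  by apply/(measurable_restrictT _ mD).1; exact: measurable_funTS.
have gD0 s : 0 <= (g \_ `]-oo, t]) s.
  by rewrite patchE; case: ifP => _; rewrite ?lexx ?c0.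
rewrite (eq_integral g); last first.
  by move=> s _; rewrite step_kernelE// ctn -EFinM.
rewrite integral_mkcond integral_cells//.
rewrite esum_mkcond -ge0_esumZl//; last by move=> i; case: ifP => // _; exact: c0.
apply: le_esum => i _; rewrite mem_set_lez; case: ifPn => [ni|_]; last first.
  by rewrite mule0 integral_ge0.
(* the left half of the i-th cell *)
pose H : set (lebesgueR R) := `](i%:~R - 1)%R, (i%:~R - 2^-1)%R]%classic.
have mH : measurable H by exact: measurable_itv_leb.
have HC : H `<=` cell i.
  move=> s; rewrite /H /cell /= !in_itv /= => /andP[-> /=] /le_trans; apply.
  by rewrite lerBlDr lerDl invr_ge0.
apply: (@le_trans _ _ (\int[leb R]_(s in H) (g \_ `]-oo, t]) s)); last first.
  apply: ge0_subset_integral => //; first exact: measurable_itv_leb.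
  exact: measurable_funTS.
have H2 : leb R H = (2^-1)%:E.
  rewrite /H leb_itv_bndc; last by rewrite lerD2l lerN2 invf_le1// ler1n.
  by congr EFin; field.
rewrite (eq_integral (cst (c i))).
  rewrite integral_cst//; apply: (@le_trans _ _ (c i * leb R H)) => //.
  by rewrite H2 muleC.
move=> s /set_mem Hs; rewrite patchE ifT; last first.
  apply/mem_set; move: Hs; rewrite /H /= !in_itv /= => /andP[_ si].
  apply: (le_trans si); apply: le_trans (ltW nt).
  by rewrite lerD2r ler_int.
by rewrite /g; have /cellP -> := HC _ Hs.
Qed.

End hardy_operators.

(** * Essential suprema *)

Section essential_supremum.
Context d (T : measurableType d) (R : realType) (mu : {measure set T -> \bar R}).
Local Open Scope ereal_scope.

Lemma ess_sup_ge_on (D : set T) (f : T -> \bar R) (c : \bar R) :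
  measurable D -> 0 < mu D -> (forall x, D x -> c <= f x) ->
  c <= ess_sup mu f.
Proof.
move=> mD D0 cf; rewrite leNgt; apply/negP => fc.
have : mu.-negligible D.
  apply: negligibleS (ess_sup_ge mu f) => x Dx /= fx.
  by have := le_lt_trans (le_trans (cf _ Dx) fx) fc; rewrite ltxx.
by move=> /(measure_negligible mD) D00; move: D0; rewrite D00 ltxx.
Qed.

(** The case of exponent infinity of Jensen's inequality: an average is at most
    the essential supremum. *)
Lemma ge0_integral_le_ess_sup (D : set T) (f : T -> \bar R) :
  measurable D -> mu D = 1 -> measurable_fun D f ->
  (forall x, 0 <= f x) -> \int[mu]_(x in D) f x <= ess_sup mu f.
Proof.
move=> mD D1 mf f0.
have M0 : 0 <= ess_sup mu f by apply: (ess_sup_ge_on mD); rewrite ?D1.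
rewrite -[leRHS]mule1 -D1 -integral_cst//.
apply: ae_ge0_le_integral => //; apply: filterS (ess_sup_ge mu f) => x fx _.
exact: fx.
Qed.

End essential_supremum.

(** * Discrete constants are continuous constants *)

Section transfer.
Context {R : realType}.
Implicit Types (p q : \bar R) (U : int -> int -> R) (a v w : int -> R).
Local Open Scope ereal_scope.

Lemma le_poweR2r (r : R) (x y : \bar R) : (0 <= r)%R -> 0 <= x -> x <= y ->
  x `^ r <= y `^ r.
Proof.
move=> r0 x0 xy; apply: gt0_ler_poweR => //; rewrite in_itv /= leey andbT//.
exact: le_trans xy.
Qed.

Lemma le_esum_term (T : choiceType) (I : set T) (c : T -> \bar R) (i : T) :
  I i -> (forall j, 0 <= c j) -> c i <= \esum_(j in I) c j.
Proof.
move=> Ii c0; rewrite (esumID [set i])// (_ : I `&` [set i] = [set i]).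
  by rewrite esum_set1// leeDl// esum_ge0.
by apply/seteqP; split => [j []|j ->].
Qed.

(** The last hypothesis asks [a] to dominate the cell averages of [f] only where
    the weight does not vanish: this is what lets [a] be 0 at an index where the
    average is infinite. *)
Lemma step_continuous_lhs_le q U w (f : R -> R) a : 0 < q ->
  (forall i n, 0 <= U i n)%R -> (forall n, 0 <= w n)%R ->
  (forall s, 0 <= f s)%R ->
  measurable_fun [set: lebesgueR R] (f : lebesgueR R -> R) ->
  (forall i, 0 <= a i)%R ->
  (forall i n, (i <= n)%R -> w n <> 0%R ->
    (U i n)%:E * \int[leb R]_(s in cell i) (f s)%:E <= (U i n * a i)%:E) ->
  continuous_lhs q (step_kernel U) (step_weight w) f <= discrete_lhs q U w a.
Proof.
move=> q0 U0 w0 f0 mf a0 key.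
pose D n := \esum_(i in [set i : int | (i <= n)%R]) (U i n * a i)%:E.
have D0 n : 0 <= D n by apply: esum_ge0 => i _; rewrite lee_fin mulr_ge0.
pose T t := \int[leb R]_(s in `]-oo, t]) (step_kernel U s t * (f s)%:E).
have T0 t : 0 <= T t.
  apply: integral_ge0 => s _.
  by rewrite step_kernelE// mule_ge0 ?lee_fin.
have TD t : w (Num.ceil t) <> 0%R -> T t <= D (Num.ceil t).
  move=> wt; apply: le_trans (step_hardy_le U0 t f0 mf) _.
  by apply: le_esum => i /= it; exact: key.
case: q q0 => [r| |]//; rewrite /continuous_lhs /discrete_lhs -/D.
  rewrite lte_fin => r0; apply: le_poweR2r; first by rewrite invr_ge0 ltW.
    apply: integral_ge0 => t _; rewrite mule_ge0 ?poweR_ge0//.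
    by rewrite step_weightE ?lee_fin.
  have G0 n : 0 <= D n `^ r * (w n)%:E by rewrite mule_ge0 ?poweR_ge0 ?lee_fin.
  rewrite -(integral_ceil G0); apply: le_integralT => t.
    by rewrite mule_ge0 ?poweR_ge0// step_weightE ?lee_fin.
  rewrite step_weightE//; have [->|/eqP wt] := eqVneq (w (Num.ceil t)) 0%R.
    by rewrite !mule0.
  by rewrite lee_wpmul2r ?lee_fin// le_poweR2r ?(ltW r0)//; [exact: T0|exact: TD].
move=> _; apply/ess_supP; apply: aeW => t.
apply: le_trans (ereal_sup_ubound _); last by exists (Num.ceil (t : R)).
rewrite step_weightE//; have [->|/eqP wt] := eqVneq (w (Num.ceil t)) 0%R.
  by rewrite !mul0e.
by rewrite lee_wpmul2l ?lee_fin//; exact: TD.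
Qed.

Lemma discrete_lhs_le0 q U w a : 0 < q ->
  (forall i n, 0 <= U i n)%R -> (forall n, 0 <= w n)%R ->
  (forall i, 0 <= a i)%R -> discrete_lhs q U w a <= 0 ->
  forall i n, (i <= n)%R -> w n <> 0%R -> (U i n * a i = 0)%R.
Proof.
move=> q0 U0 w0 a0 + i n le_in wn.
pose D n := \esum_(i in [set i : int | (i <= n)%R]) (U i n * a i)%:E.
have D0 m : 0 <= D m by apply: esum_ge0 => j _; rewrite lee_fin mulr_ge0.
suff : discrete_lhs q U w a <= 0 -> D n = 0.
  move=> + L0 => /(_ L0) Dn; apply/eqP; rewrite eq_le -!lee_fin lee_fin.
  rewrite [X in _ && X]lee_fin mulr_ge0// andbT -lee_fin -[leRHS]Dn.
  apply: (@le_esum_term _ _ (fun i => (U i n * a i)%:E)) => // j.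
  by rewrite lee_fin mulr_ge0.
case: q q0 => [r| |]//; rewrite /discrete_lhs -/D.
  rewrite lte_fin => r0 L0.
  have G0 m : 0 <= D m `^ r * (w m)%:E by rewrite mule_ge0 ?poweR_ge0 ?lee_fin.
  have /poweR_eq0_eq0 : (\esum_(m in [set: int]) (D m `^ r * (w m)%:E)) `^ r^-1 = 0.
    by apply/eqP; rewrite eq_le L0 poweR_ge0.
  move=> /(_ (esum_ge0 (fun m _ => G0 m))) S0.
  have : D n `^ r * (w n)%:E = 0.
    by apply/eqP; rewrite eq_le G0 andbT -S0; exact: le_esum_term.
  move=> /eqP; rewrite mule_eq0 => /orP[/eqP/poweR_eq0_eq0|]; first exact.
  by rewrite eqe => /eqP.
move=> _ L0; have : (w n)%:E * D n = 0.
  apply/eqP; rewrite eq_le mule_ge0 ?lee_fin// andbT.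
  by apply: le_trans (ereal_sup_ubound _) L0; exists n.
by move=> /eqP; rewrite mule_eq0 eqe => /orP[/eqP|/eqP].
Qed.

Lemma discrete_rhs_single p v (i : int) : 1 <= p -> (forall n, 0 <= v n)%R ->
  v i = 0%R -> discrete_rhs p v (fun n => (n == i)%:R) <= 0.
Proof.
move=> p1 v0 vi; case: p p1 => [r| |]//; rewrite /discrete_rhs.
  rewrite lee_fin => r1; have r0 : (0 < r)%R by exact: lt_le_trans r1.
  rewrite esum1 ?poweR0r ?invr_eq0 ?gt_eqF// => n _.
  have [->|_] := eqVneq n i; first by rewrite vi mule0.
  by rewrite poweR0r ?mul0e ?gt_eqF.
move=> _; apply: ge_ereal_sup => _ [n _ <-].
by have [->|_] := eqVneq n i; rewrite ?vi ?mule0 ?mul0e.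
Qed.

(** If the right-hand side does not see the i-th entry of a sequence, neither
    does the left-hand side: test the inequality on the unit sequence at [i]. *)
Lemma discrete_constants_vanish p q U v w (C : R) (i n : int) :
  1 <= p -> 0 < q -> (forall i n, 0 <= U i n)%R ->
  (forall n, 0 <= v n)%R -> (forall n, 0 <= w n)%R ->
  discrete_constants p q U v w C -> (C * v i = 0)%R ->
  (i <= n)%R -> w n <> 0%R -> U i n = 0%R.
Proof.
move=> p1 q0 U0 v0 w0 [C0 HC] Cv le_in wn.
pose e (j : int) : R := (j == i)%:R.
have e0 j : (0 <= e j)%R by rewrite ler0n.
have L0 : discrete_lhs q U w e <= 0.
  apply: le_trans (HC e e0) _.
  have [->|CN0] := eqVneq C 0%R; first by rewrite mul0e.
  apply: mule_ge0_le0; rewrite ?lee_fin//; apply: discrete_rhs_single => //.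
  by move/eqP: Cv; rewrite mulf_eq0 (negbTE CN0) => /eqP.
have := discrete_lhs_le0 q0 U0 w0 e0 L0 le_in wn.
by rewrite /e eqxx mulr1.
Qed.

Section averages.
Variables (p : \bar R) (v : int -> R) (f : R -> R).
Hypotheses (p1 : 1 <= p) (v0 : forall n, (0 <= v n)%R).
Hypotheses (f0 : forall s, (0 <= f s)%R).
Hypothesis mf : measurable_fun [set: lebesgueR R] (f : lebesgueR R -> R).

Let A n := \int[leb R]_(s in cell n) (f s)%:E.

Let A0 n : 0 <= A n.
Proof. by apply: integral_ge0 => s _; rewrite lee_fin. Qed.

Let mEf : measurable_fun [set: lebesgueR R] (fun s : lebesgueR R => (f s)%:E).
Proof. exact/measurable_EFinP. Qed.

Let mcell n : measurable (cell n : set (lebesgueR R)).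
Proof. exact: measurable_itv_leb. Qed.

Let mv : measurable_fun [set: lebesgueR R]
  (fun t : lebesgueR R => (v (Num.ceil (t : R)))%:E).
Proof. exact: (@measurable_fun_ceil R _ _ (fun n => (v n)%:E)). Qed.

Lemma esum_average_le (r : R) : (1 <= r)%R ->
  \esum_(n in [set: int]) (A n `^ r * (v n)%:E) <=
  \int[leb R]_t ((f t)%:E `^ r * step_weight v t).
Proof.
move=> r1; pose h (t : lebesgueR R) := (f t)%:E `^ r * step_weight v t.
have h0 t : 0 <= h t by rewrite mule_ge0 ?poweR_ge0// step_weightE ?lee_fin.
have mfr : measurable_fun [set: lebesgueR R]
    (fun t : lebesgueR R => (f t)%:E `^ r).
  exact: (measurableT_comp (measurable_poweR r)).
have mh : measurable_fun [set: lebesgueR R] h.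
  apply: emeasurable_funM => //.
  by apply: eq_measurable_fun mv => t _; rewrite step_weightE.
rewrite (integral_cells h0 mh); apply: le_esum => n _.
rewrite (eq_integral (fun t : lebesgueR R => (f t)%:E `^ r * (v n)%:E)).
  rewrite ge0_integralZr ?lee_fin//; first last.
  - by move=> t _; exact: poweR_ge0.
  - exact: measurable_funTS.
  rewrite lee_wpmul2r ?lee_fin//; apply: poweR_le_integral_poweR => //.
  exact: leb_cell.
by move=> t /set_mem/cellP tn; rewrite /h step_weightE// tn.
Qed.

Lemma average_le_ess_sup n :
  A n * (v n)%:E <= ess_sup (leb R) (fun t => (f t)%:E * step_weight v t).
Proof.
pose h (t : lebesgueR R) := (f t)%:E * step_weight v t.
have h0 t : 0 <= h t by rewrite mule_ge0 ?lee_fin// step_weightE ?lee_fin.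
have mh : measurable_fun [set: lebesgueR R] h.
  apply: emeasurable_funM => //.
  by apply: eq_measurable_fun mv => t _; rewrite step_weightE.
have -> : A n * (v n)%:E = \int[leb R]_(t in cell n) h t.
  rewrite (eq_integral (fun t : lebesgueR R => (f t)%:E * (v n)%:E)).
    rewrite ge0_integralZr ?lee_fin//.
    - exact: measurable_funTS.
    - by move=> t _; rewrite lee_fin.
  by move=> t /set_mem/cellP tn; rewrite /h step_weightE// tn.
apply: ge0_integral_le_ess_sup => //; first exact: leb_cell.
exact: measurable_funTS.
Qed.

Lemma discrete_rhs_average_le :
  discrete_rhs p v (fun n => fine (A n)) <=
  continuous_rhs p (step_weight v) f.
Proof.
have fineA n : (fine (A n))%:E <= A n.
  by case: (A n) (A0 n) => //= *; rewrite leey.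
have fineA0 n : 0 <= (fine (A n))%:E by rewrite lee_fin fine_ge0.
case: p p1 => [r| |]//; rewrite /discrete_rhs /continuous_rhs.
  rewrite lee_fin => r1; have r0 : (0 <= r)%R by exact: le_trans r1.
  apply: le_poweR2r; rewrite ?invr_ge0//.
    by apply: esum_ge0 => n _; rewrite mule_ge0 ?poweR_ge0 ?lee_fin.
  apply: le_trans (esum_average_le r1); apply: le_esum => n _.
  by rewrite lee_wpmul2r ?lee_fin// le_poweR2r.
move=> _; apply: ge_ereal_sup => _ [n _ <-].
apply: le_trans (average_le_ess_sup n).
by rewrite lee_wpmul2r ?lee_fin.
Qed.

Lemma continuous_rhs_pinfty n : A n = +oo -> v n <> 0%R ->
  continuous_rhs p (step_weight v) f = +oo.
Proof.
move=> An vn; have {}vn : (0 < v n)%R.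
  by rewrite lt_neqAle v0 andbT; apply/eqP/nesym.
apply/eqP; rewrite -leye_eq.
case: p p1 => [r| |]//; rewrite /continuous_rhs.
  rewrite lee_fin => r1; have r0 : (0 < r)%R by exact: lt_le_trans r1.
  rewrite -(@poweRyr R r^-1) ?invr_eq0 ?gt_eqF//.
  apply: le_poweR2r; rewrite ?invr_ge0 ?(ltW r0)//.
  apply: le_trans (esum_average_le r1).
  have := @le_esum_term _ setT (fun n => A n `^ r * (v n)%:E) n I.
  rewrite An poweRyr ?gt_eqF// gt0_mulye ?lte_fin//; apply => j.
  by rewrite mule_ge0 ?poweR_ge0 ?lee_fin.
move=> _; apply: le_trans (average_le_ess_sup n).
by rewrite An gt0_mulye ?lte_fin.
Qed.

End averages.

Lemma sub_discrete_continuous_constants p q U v w : 1 <= p -> 0 < q ->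
  (forall i n, 0 <= U i n)%R ->
  (forall n, 0 <= v n)%R -> (forall n, 0 <= w n)%R ->
  discrete_constants p q U v w `<=`
  continuous_constants p q (step_kernel U) (step_weight v) (step_weight w).
Proof.
move=> p1 q0 U0 v0 w0 C CD; have [C0 HC] := CD; split => // f f0 mf.
have [->|CN0] := eqVneq (C%:E * continuous_rhs p (step_weight v) f) +oo.
  exact: leey.
pose A n := \int[leb R]_(s in cell n) (f s)%:E.
have A0 n : 0 <= A n by apply: integral_ge0 => s _; rewrite lee_fin.
have a0 n : (0 <= fine (A n))%R by exact: fine_ge0.
apply: le_trans (le_trans (HC _ a0) _); last first.
  by apply: lee_wpmul2l; rewrite ?lee_fin//; exact: discrete_rhs_average_le.
apply: step_continuous_lhs_le => // i n le_in wn; rewrite -/(A i).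
have [Ai|Aioo] := eqVneq (A i) +oo; last first.
  by rewrite EFinM fineK// ge0_fin_numE// lt_neqAle Aioo leey.
suff -> : U i n = 0%R by rewrite mul0e mul0r.
apply: (discrete_constants_vanish p1 q0 U0 v0 w0 CD _ le_in wn).
have [->|/eqP vi] := eqVneq (v i) 0%R; first by rewrite mulr0.
have [->|C1] := eqVneq C 0%R; first by rewrite mul0r.
case/eqP: CN0; rewrite (continuous_rhs_pinfty p1 v0 f0 mf Ai vi).
by rewrite gt0_muley// lte_fin lt_neqAle eq_sym C1.
Qed.

End transfer.

(** * Continuous constants, scaled, are discrete constants *)

Section converse.
Context {R : realType}.
Implicit Types (p q : \bar R) (U : int -> int -> R) (a v w : int -> R).
Local Open Scope ereal_scope.

Definition half_cell (n : int) : set R := `](n%:~R - 2^-1)%R, n%:~R].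

Lemma half_cellW n : half_cell n `<=` cell n.
Proof.
move=> t; rewrite /half_cell /cell /= !in_itv /= => /andP[nt ->]; rewrite andbT.
by rewrite (le_lt_trans _ nt)// lerD2l lerN2 invf_le1// ler1n.
Qed.

Lemma leb_half_cell n : leb R (half_cell n) = (2^-1)%:E.
Proof.
by rewrite /half_cell leb_itv_bndc ?lerBlDr ?lerDl ?invr_ge0// opprB addrC subrK.
Qed.

Lemma measurable_half_cell n : measurable (half_cell n : set (lebesgueR R)).
Proof. exact: measurable_itv_leb. Qed.

(** Keeping only the right half of each cell costs a factor 1/2: [h] dominates
    the measurable function that is [K n] on the right half of the n-th cell and
    0 elsewhere. *)
Lemma half_esum_le_integral (K : int -> \bar R) (h : R -> \bar R) :
  (forall n, 0 <= K n) -> (forall t, 0 <= h t) ->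
  (forall n t, half_cell n t -> K n <= h t) ->
  (2^-1)%:E * (\esum_(n in [set: int]) K n) <= \int[leb R]_t h t.
Proof.
move=> K0 h0 Kh.
pose S : set (lebesgueR R) := \bigcup_n half_cell n.
have mS : measurable S.
  by apply: countable_bigcupT_measurable => // n; exact: measurable_half_cell.
pose g (t : lebesgueR R) := K (Num.ceil (t : R)).
have mg : measurable_fun [set: lebesgueR R] g by exact: measurable_fun_ceil.
have mgS : measurable_fun [set: lebesgueR R] (g \_ S).
  by apply/(measurable_restrictT _ mS).1; exact: measurable_funTS.
have gS0 t : 0 <= (g \_ S) t.
  by rewrite patchE; case: ifP => _; rewrite ?lexx ?K0.
apply: (@le_trans _ _ (\int[leb R]_t (g \_ S) t)); last first.
  apply: le_integralT => // t; rewrite patchE.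
  case: ifPn => [/set_mem[n _ nt]|_]; last exact: h0.
  by rewrite /g; have /cellP -> := half_cellW nt; exact: Kh.
rewrite (integral_cells gS0 mgS) -ge0_esumZl//; apply: le_esum => n _.
apply: (@le_trans _ _ (\int[leb R]_(t in half_cell n) (g \_ S) t)).
  rewrite (eq_integral (cst (K n))).
    rewrite integral_cst; last exact: measurable_half_cell.
    apply: (@le_trans _ _ (K n * leb R (half_cell n))) => //.
    by rewrite leb_half_cell muleC.
  move=> t /set_mem nt; rewrite patchE ifT; last by apply/mem_set; exists n.
  by rewrite /g; have /cellP -> := half_cellW nt.
apply: ge0_subset_integral => //.
- exact: measurable_half_cell.
- exact: measurable_itv_leb.
- exact: measurable_funTS.
- exact: half_cellW.
Qed.

Lemma continuous_rhs_ceil_le p v a : 1 <= p ->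
  (forall n, 0 <= v n)%R -> (forall n, 0 <= a n)%R ->
  continuous_rhs p (step_weight v) (fun t => a (Num.ceil t)) <=
  discrete_rhs p v a.
Proof.
move=> p1 v0 a0; case: p p1 => [r| |]//.
  move=> _; rewrite /continuous_rhs /discrete_rhs -integral_ceil.
    by under eq_integral do rewrite step_weightE//.
  by move=> n; rewrite mule_ge0 ?poweR_ge0 ?lee_fin.
move=> _; apply/ess_supP; apply: aeW => t; rewrite step_weightE//.
by apply: ereal_sup_ubound; exists (Num.ceil (t : R)).
Qed.

(** The source of the constant: one factor 1/2 from [step_hardy_ge], inside the
    power q, and one factor 1/2 from [half_esum_le_integral], outside it. *)
Lemma discrete_lhs_le_ceil q U w a : 0 < q ->
  (forall i n, 0 <= U i n)%R -> (forall n, 0 <= w n)%R ->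
  (forall n, 0 <= a n)%R ->
  discrete_lhs q U w a <= (2 `^ (1 + fine q^-1))%:E *
    continuous_lhs q (step_kernel U) (step_weight w) (fun t => a (Num.ceil t)).
Proof.
move=> q0 U0 w0 a0.
pose D n := \esum_(i in [set i : int | (i <= n)%R]) (U i n * a i)%:E.
have D0 n : 0 <= D n by apply: esum_ge0 => i _; rewrite lee_fin mulr_ge0.
pose T t := \int[leb R]_(s in `]-oo, t])
  (step_kernel U s t * (a (Num.ceil (s : R)))%:E).
have T0 t : 0 <= T t.
  apply: integral_ge0 => s _.
  by rewrite step_kernelE// mule_ge0 ?lee_fin.
have DT n t : half_cell n t -> (2^-1)%:E * D n <= T t.
  by rewrite /half_cell /= in_itv /=; exact: step_hardy_ge.
have half0 : 0 <= (2^-1)%:E :> \bar R by rewrite lee_fin.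
have D20 n : 0 <= (2^-1)%:E * D n by rewrite mule_ge0.
have wE n t : half_cell n t -> step_weight w t = (w n)%:E.
  by move=> /half_cellW/cellP tn; rewrite step_weightE// tn.
have c0 : (0 <= 2 `^ (1 + fine q^-1) :> R)%R by exact: powR_ge0.
case: q q0 c0 => [r| |]//; rewrite /discrete_lhs /continuous_lhs -/D.
  rewrite lte_fin => r0 c0.
  pose K n := ((2^-1)%:E * D n) `^ r * (w n)%:E.
  have K0 n : 0 <= K n by rewrite mule_ge0 ?poweR_ge0 ?lee_fin.
  have h0 t : 0 <= T t `^ r * step_weight w t.
    by rewrite mule_ge0 ?poweR_ge0// step_weightE// lee_fin.
  have G0 n : 0 <= D n `^ r * (w n)%:E by rewrite mule_ge0 ?poweR_ge0 ?lee_fin.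
  have Kh n t : half_cell n t -> K n <= T t `^ r * step_weight w t.
    move=> nt; rewrite (wE _ _ nt) lee_wpmul2r ?lee_fin//.
    by apply: le_poweR2r => //; [exact: ltW|exact: DT].
  have := half_esum_le_integral K0 h0 Kh.
  have -> : \esum_(n in [set: int]) K n =
      (2^-1 `^ r)%:E * \esum_(n in [set: int]) (D n `^ r * (w n)%:E).
    rewrite -ge0_esumZl ?powR_ge0//; apply: eq_esum => n _.
    by rewrite /K poweRM// muleA.
  have S0 : 0 <= \esum_(n in [set: int]) (D n `^ r * (w n)%:E).
    exact: esum_ge0.
  move=> H; have {H} := @le_poweR2r _ r^-1 _ _ _ _ H.
  rewrite invr_ge0 (ltW r0) => /(_ isT).
  rewrite !mule_ge0 ?lee_fin ?powR_ge0// => /(_ isT).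
  rewrite poweRM// ?mule_ge0 ?lee_fin ?powR_ge0//.
  rewrite poweRM// ?lee_fin ?powR_ge0// !poweR_EFin -powRrM mulfV ?gt_eqF//.
  rewrite powRr1// => H.
  have cE : (2 `^ (1 + fine r%:E^-1) * (2^-1 `^ r^-1 * 2^-1) = 1)%R.
    rewrite inver gt_eqF//= powRD; last by rewrite pnatr_eq0 implybT.
    rewrite powRr1// -(@powR_inv1 _ 2)// -powRrM mulN1r powRN powR_inv1//.
    by field; rewrite gt_eqF// powR_gt0.
  have c0E : 0 <= (2 `^ (1 + fine r%:E^-1))%:E :> \bar R by rewrite lee_fin.
  apply: le_trans (lee_wpmul2l c0E H).
  by rewrite (muleA (2^-1 `^ _)%:E) muleA -!EFinM cE mul1e.
move=> _ c0; rewrite invey addr0 powRr1//; apply: ge_ereal_sup => _ [n _ <-].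
rewrite -[leLHS]mul1e -(_ : 2%:E * (2^-1)%:E = 1); last first.
  by rewrite -EFinM divff.
rewrite -muleA lee_wpmul2l ?lee_fin//.
apply: (@ess_sup_ge_on _ (lebesgueR R) R (leb R) (half_cell n)).
- exact: measurable_half_cell.
- by rewrite [X in _ < X]leb_half_cell lte_fin.
- move=> t nt; rewrite (wE _ _ nt) muleCA lee_wpmul2l ?lee_fin//; exact: DT.
Qed.

Lemma discrete_constants_scale p q U v w (C : R) : 1 <= p -> 0 < q ->
  (forall i n, 0 <= U i n)%R ->
  (forall n, 0 <= v n)%R -> (forall n, 0 <= w n)%R ->
  continuous_constants p q (step_kernel U) (step_weight v) (step_weight w) C ->
  discrete_constants p q U v w (2 `^ (1 + fine q^-1) * C)%R.
Proof.
move=> p1 q0 U0 v0 w0 [C0 HC]; split=> [|a a0]; first by rewrite mulr_ge0 ?powR_ge0.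
apply: le_trans (discrete_lhs_le_ceil q0 U0 w0 a0) _.
rewrite EFinM -muleA lee_wpmul2l ?lee_fin ?powR_ge0//.
apply: le_trans (HC _ _ _) _ => //; first exact: measurable_fun_ceil.
by rewrite lee_wpmul2l ?lee_fin//; exact: continuous_rhs_ceil_le.
Qed.

End converse.

(** * Comparison of the optimal constants *)

Theorem theorem2p1 (R : realType) (p q : \bar R) (U : int -> int -> R)
    (v w : int -> R)
    (hp : (1 <= p)%E) (hq : (0 < q)%E)
    (hU : regular_kernel U)
    (hv : forall n : int, 0 <= v n) (hw : forall n : int, 0 <= w n) :
  let Cs := discrete_constants p q U v w in
  let Cs' := continuous_constants p q
               (step_kernel U) (step_weight v) (step_weight w) in
  ((exists C : R, Cs C) <-> (exists C' : R, Cs' C')) /\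
  (optimal_constant Cs' <= optimal_constant Cs)%E /\
  (optimal_constant Cs
     <= (2 `^ (1 + fine (q^-1)%E))%:E * optimal_constant Cs')%E.
Proof.
move=> Cs Cs'; have [U0 _ _ _] := hU.
have sub := sub_discrete_continuous_constants hp hq U0 hv hw.
have scale := fun C => @discrete_constants_scale R p q U v w C hp hq U0 hv hw.
split; [|split].
- by split=> [[C /sub]|[C /scale]]; eexists; eassumption.
- by apply: ereal_inf_le_tmp => _ [C /sub CC <-]; exists C.
- rewrite /optimal_constant -ereal_inf_pZl ?powR_gt0//.
  apply: ereal_inf_le_tmp => _ [_ [C /scale CC <-] <-].
  by eexists; [exact: CC|rewrite EFinM].
Qed.
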